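(* Let $G$ be a graph, let $q\geq 0$ be an integer, and let $e\in E(G)$. Then \[\operatorname{Z}_q(G)-2\leq \operatorname{Z}_q(G-e)\leq \operatorname{Z}_q(G)+1,\] where $G-e$ is the graph obtained from $G$ by deleting the edge $e$ (keeping all vertices).
   Context: Graphs are finite, simple and undirected. The $\operatorname{Z}_q$-forcing game ($q\ge 0$ an integer) is played on a graph $G$ by two players, Blue (who has tokens) and White. All vertices of $G$ are initially white. Blue repeatedly applies one of the following rules until all vertices are blue. Rule 1: for one token, Blue can change any vertex from white to blue. Rule 2: at no cost, if a blue vertex $v$ of $G$ has exactly one white neighbor $w$, Blue may turn $w$ blue. Rule 3: let $B$ be the current set of blue vertices and let $W_1,\dots,W_k$ be the vertex sets of the connected components of $G[V(G)\setminus B]$. Blue selects at least $q+1$ of the $W_i$ and announces the selection to White (so this rule needs $k\ge q+1$). White then selects a nonempty subset $\{W_{i_1},\dots,W_{i_\ell}\}$ of the announced components and announces it back to Blue. At no cost, Blue can apply Rule 2 on the induced subgraph $G[B\cup W_{i_1}\cup\cdots\cup W_{i_\ell}]$. The $\operatorname{Z}_q$-forcing number $\operatorname{Z}_q(G)$ is the fewest number of tokens Blue must spend to color all of $G$ blue, under adversarial play by White. *)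

(* Defs.v *)
From mathcomp Require Import all_boot.
From mathcomp Require Import boolp.

Set Implicit Arguments.
Unset Strict Implicit.
Unset Printing Implicit Defensive.

(* A simple graph on the vertex set T is a symmetric irreflexive relation
   adj : rel T. *)

Definition del_edge (T : finType) (adj : rel T) (x y : T) : rel T :=
  [rel u v | adj u v && ([set u; v] != [set x; y])].

Section Game.

Variables (T : finType) (q : nat) (adj : rel T).
Implicit Types (B U C : {set T}) (k : nat).

Definition white_components B : {set {set T}} :=
  equivalence_partition
    (connect [rel u v | [&& u \notin B, v \notin B & adj u v]]) (~: B).

Definition forces B U v w : Prop :=
  v \in B /\ [set z in U :\: B | adj v z] = [set w].

(* Blue may also decline to force, in which case the position is unchanged. *)
Definition response B U C : Prop :=
  C = B \/ exists v w, forces B U v w /\ C = w |: B.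

(* blue_wins k B: from the position where B is the set of blue vertices, Blue
   can make every vertex blue spending at most k tokens, whatever White does.
   In Rule 3, S is Blue's announcement, R is White's answer, and
   reply R is the position Blue then moves to. *)
Inductive blue_wins : nat -> {set T} -> Prop :=
| AllBlue k : blue_wins k [set: T]
| Rule1 k B v :
    v \notin B -> blue_wins k (v |: B) -> blue_wins k.+1 B
| Rule2 k B v w :
    forces B [set: T] v w -> blue_wins k (w |: B) -> blue_wins k B
| Rule3 k B (S : {set {set T}}) (reply : {set {set T}} -> {set T}) :
    S \subset white_components B -> q.+1 <= #|S| ->
    (forall R : {set {set T}}, R \subset S -> R != set0 ->
       response B (B :|: cover R) (reply R)) ->
    (forall R : {set {set T}}, R \subset S -> R != set0 ->
       blue_wins k (reply R)) ->
    blue_wins k B.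

Lemma blue_wins_tokens B : blue_wins #|~: B| B.
Proof.
move: {2}#|~: B| (erefl #|~: B|) => n; elim: n B => [|n IHn] B.
  move/eqP; rewrite cards_eq0 => /eqP BC0.
  by rewrite -[B]setCK BC0 setC0; apply: AllBlue.
move=> cardB; have /card_gt0P[v] : 0 < #|~: B| by rewrite cardB.
rewrite inE => vB; have E : #|~: B| = #|~: (v |: B)|.+1.
  by rewrite (cardsD1 v) inE vB add1n setCU setIC -setDE.
by rewrite E; apply: (Rule1 vB); apply: IHn; move: cardB; rewrite E => -[].
Qed.

Lemma blue_wins_ex : exists k, `[< blue_wins k set0 >].
Proof. by exists #|~: (set0 : {set T})|; apply/asboolP/blue_wins_tokens. Qed.

Definition Zq : nat := ex_minn blue_wins_ex.

End Game.

(* Main.v *)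
Require Import Defs.
From mathcomp Require Import all_boot.
From mathcomp Require boolp.

(** A won position of one graph is turned into a won position of another one
    by letting Blue imitate a winning play: [blue_wins_transfer] keeps the blue
    set B' of the second game above the blue set B of the first.  An ordinary
    force [v -> w] of the first game is either superfluous (w is already in
    B') or still available, because v has no more white neighbours than before;
    the one exception is an edge [v w] missing from the second graph.

    The delicate move is Rule 3.  A component W announced in the first game may
    have shrunk or split in the second, and White may then answer with a piece
    of W that does not contain the vertex Blue meant to force.  Moreover Blue
    has no say in which piece of W will be used by which answer.  The way out,
    [announce_transversal], is that Blue announces a single, well chosen piece
    of each W: if White's answer were the whole announcement S, Blue would
    force some w in some W of S, and the same force stays legal for every
    answer containing W.  So the piece of W around w serves all those
    answers, and the remaining ones are handled by induction on S without W.
    (If for some answer Blue would make no force outside B', the second game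
    is already won by imitating the rest of that branch.)

    Let e = xy.  Once x and y are blue, e affects neither the white components
    nor the white neighbours of any vertex, so a win transfers between G and
    G - e in both directions.  Hence two tokens, spent on x and y, turn a
    strategy for G - e into one for G.  Conversely a strategy for G is
    followed on G - e until it forces along e; the endpoint that should have
    been forced is bought instead, and from then on x and y are blue. *)

(** * White components *)

Lemma white_equivalence {T : finType} {adj : rel T} (B : {set T}) :
  symmetric adj ->
  {in ~: B & &, equivalence_rel
     (connect [rel u v | [&& u \notin B, v \notin B & adj u v]])}.
Proof.
move=> adj_sym; have sym : connect_sym
    [rel u v | [&& u \notin B, v \notin B & adj u v]].
  by apply: sym_connect_sym => u v /=; rewrite adj_sym andbCA.
move=> u v w _ _ _; split; first exact: connect0.
by move=> uv; apply: same_connect.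
Qed.

Lemma white_components_partition {T : finType} {adj : rel T} (B : {set T}) :
  symmetric adj -> partition (white_components adj B) (~: B).
Proof. by move=> adj_sym; apply/equivalence_partitionP/white_equivalence. Qed.

Lemma white_component_mem {T : finType} {adj : rel T} {B : {set T}} {w : T} :
  symmetric adj -> w \notin B ->
  w \in pblock (white_components adj B) w /\
  pblock (white_components adj B) w \in white_components adj B.
Proof.
move=> adj_sym wB; have /and3P[/eqP cov _ _] :=
  white_components_partition B adj_sym.
by rewrite mem_pblock pblock_mem // cov inE.
Qed.

(** A path between white vertices survives when fewer vertices are blue, so
    components only get finer along [B \subset B']. *)
Lemma white_component_sub {T : finType} {adj adj' : rel T}
    {B B' W : {set T}} {w : T} :
  symmetric adj -> symmetric adj' -> B \subset B' ->
  (forall u v, v \notin B' -> adj' u v -> adj u v) ->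
  W \in white_components adj B -> w \in W -> w \notin B' ->
  pblock (white_components adj' B') w \subset W.
Proof.
move=> adj_sym adj'_sym sBB' sub WP wW wB'.
have /and3P[/eqP cov' _ _] := white_components_partition B' adj'_sym.
have /and3P[/eqP cov triv _] := white_components_partition B adj_sym.
have wB : w \notin B by apply: contra wB' => /(subsetP sBB').
rewrite -(def_pblock triv WP wW); apply/subsetP => z zw.
have zB' : z \in ~: B'.
  rewrite -cov'; apply/bigcupP; exists (pblock (white_components adj' B') w) => //.
  by have [] := white_component_mem adj'_sym wB'.
have zB : z \notin B by move: zB'; rewrite inE; apply: contra => /(subsetP sBB').
move: zw; rewrite /white_components.
rewrite !pblock_equivalence_partition ?inE //; try exact: white_equivalence;
  last by move: zB'; rewrite inE.
apply: connect_sub => u v /= /and3P[uB' vB' uv]; apply: connect1 => /=.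
rewrite (sub _ _ vB' uv) andbT.
by apply/andP; split; [apply: contra uB' | apply: contra vB'] => /(subsetP sBB').
Qed.

(** * Imitating Rule 3 *)

Lemma cover_subset {T : finType} {R S : {set {set T}}} :
  R \subset S -> cover R \subset cover S.
Proof.
move=> /subsetP sRS; apply/bigcupsP => W WR.
by apply: bigcup_sup (sRS _ WR).
Qed.

(** In the hypothesis the force depends on the whole answer R; the conclusion
    provides an announcement S', with one piece of each member of S, for
    which every answer still admits a good force.  The size of S' is what makes
    it announceable, and [cover S' \subset cover S] keeps the pieces chosen for
    different members of S apart in the induction. *)
Lemma announce_transversal {T : finType} {adj adj' : rel T}
    {B B' : {set T}} {P : {set T} -> Prop} {S : {set {set T}}} :
  symmetric adj -> symmetric adj' -> B \subset B' ->
  (forall u v, v \notin B' -> adj' u v -> adj u v) ->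
  S \subset white_components adj B ->
  (forall R : {set {set T}}, R \subset S -> R != set0 ->
     exists v w, [/\ forces adj B (B :|: cover R) v w, w \notin B',
                     adj' v w & P (w |: B')]) ->
  exists S' : {set {set T}},
    [/\ S' \subset white_components adj' B', #|S'| = #|S|,
        cover S' \subset cover S &
        forall R : {set {set T}}, R \subset S' -> R != set0 ->
          exists v w, forces adj' B' (B' :|: cover R) v w /\ P (w |: B')].
Proof.
move=> adj_sym adj'_sym sBB' sub.
have /and3P[_ triv _] := white_components_partition B adj_sym.
move: {2}#|S| (erefl #|S|) => n; elim: n S => [|n IHn] S cardS SP forceS.
  exists set0; split; rewrite ?sub0set ?cards0 //.
    by rewrite /cover big_set0 sub0set.
  by move=> R; rewrite subset0 => ->.
have S0 : S != set0 by rewrite -card_gt0 cardS.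
have [v [w [[vB Ew] wB' vw Pw]]] := forceS S (subxx _) S0.
have wB : w \notin B by apply: contra wB' => /(subsetP sBB').
have /bigcupP[W WS wW] : w \in cover S.
  have : w \in [set w] by rewrite inE.
  by rewrite -Ew !inE (negPf wB) => /andP[].
have WP : W \in white_components adj B by apply: (subsetP SP).
have sDS : S :\ W \subset S by apply: subD1set.
have [||R sR R0|S' [S'P cardS' covS' forceS']] := IHn (S :\ W).
- by move: cardS; rewrite (cardsD1 W) WS => -[].
- exact: subset_trans sDS SP.
- by apply: forceS => //; apply: subset_trans sR sDS.
have sWw := white_component_sub adj_sym adj'_sym sBB' sub WP wW wB'.
have [wWw WwP] := white_component_mem adj'_sym wB'.
set Ww := pblock _ w in sWw wWw WwP.
have WwS' : Ww \notin S'.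
  apply/negP => WwS'; have /(subsetP covS') /bigcupP[V /setD1P[VW VS] wV] :
    w \in cover S' by apply/bigcupP; exists Ww.
  have /trivIsetP/(_ _ _ (subsetP SP _ VS) WP VW) := triv.
  by rewrite -setI_eq0 => /eqP/setP/(_ w); rewrite !inE wV wW.
have covU : cover (Ww |: S') \subset cover S.
  apply/bigcupsP => V /setU1P[->|VS'].
    by apply: subset_trans sWw _; apply: bigcup_sup WS.
  apply: subset_trans (bigcup_sup _ VS') _.
  by apply: subset_trans covS' _; apply: cover_subset sDS.
exists (Ww |: S'); split => //.
- by rewrite subUset sub1set WwP S'P.
- by rewrite cardsU1 WwS' cardS' [in RHS](cardsD1 W) WS.
move=> R sR R0; case: (boolP (Ww \in R)) => [WwR|WwR]; last first.
  apply: forceS' => //; apply/subsetP => V VR.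
  have /setU1P[EV|//] := subsetP sR _ VR.
  by rewrite -EV VR in WwR.
(* The force chosen for the full announcement S is legal here as well: v has
   no white neighbour other than w in the cover of S. *)
exists v, w; split => //; split; first exact: subsetP vB.
apply/setP => z; rewrite !inE; apply/andP/eqP => [[/andP[zB' zU] vz]|->].
  have zR : z \in cover R by move: zU; rewrite (negPf zB').
  have zS : z \in cover S.
    by apply: (subsetP covU); apply: (subsetP _ _ zR); apply: cover_subset sR.
  have zB : z \notin B by apply: contra zB' => /(subsetP sBB').
  have : z \in [set w] by rewrite -Ew !inE zB zS orbT sub.
  by move/set1P.
rewrite wB' vw; split => //=; apply/orP; right.
by apply/bigcupP; exists Ww.
Qed.

(** * Imitating a whole play *)

(** B0 is blue throughout the imitation, so an additional edge of the second
    graph inside B0 neither joins two white vertices nor gives a blue vertex a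
    new white neighbour.  An edge missing from the second graph matters only
    when the first play forces along it; the last hypothesis says that Blue
    then wins anyway, d being the number of tokens held in reserve for that. *)
Lemma blue_wins_transfer {T : finType} {q : nat} {adj adj' : rel T}
    (B0 : {set T}) (d : nat) :
  symmetric adj -> symmetric adj' ->
  (forall u v, v \notin B0 -> adj' u v -> adj u v) ->
  (forall k (B B' : {set T}) v w, B :|: B0 \subset B' -> v \in B ->
     w \notin B' -> adj v w -> ~~ adj' v w ->
     blue_wins q adj k (w |: B) -> blue_wins q adj' (d + k) B') ->
  forall k (B B' : {set T}), blue_wins q adj k B -> B :|: B0 \subset B' ->
  blue_wins q adj' (d + k) B'.
Proof.
move=> adj_sym adj'_sym sub missing k B B' win; move: B'.
have grow (B1 B' : {set T}) w : B1 :|: B0 \subset B' -> (w |: B1) :|: B0 \subset w |: B'.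
  by move=> sB; rewrite -setUA setUS.
have stay (B1 B' : {set T}) w :
    B1 :|: B0 \subset B' -> w \in B' -> (w |: B1) :|: B0 \subset B'.
  by move=> sB wB'; rewrite -setUA subUset sub1set wB'.
have sub' (B1 B' : {set T}) : B1 :|: B0 \subset B' ->
    B1 \subset B' /\ forall u v, v \notin B' -> adj' u v -> adj u v.
  rewrite subUset => /andP[sB sB0]; split=> // u v vB'.
  by apply: sub; apply: contra vB' => /(subsetP sB0).
elim: win => {k B}.
- move=> k B'; rewrite setTU subTset => /eqP ->; exact: AllBlue.
- move=> k B v vB _ IH B' sB.
  case: (boolP (v \in B')) => vB'.
    (* Tokens cannot be thrown away, so the one saved here is spent on an
       arbitrary white vertex. *)
    case: (boolP (B' == setT)) => [/eqP ->|B'T]; first exact: AllBlue.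
    have /subsetPn[u _ uB'] : ~~ (setT \subset B') by rewrite subTset.
    rewrite addnS; apply: (Rule1 uB'); apply: IH.
    by apply: subset_trans (stay _ _ _ sB vB') (subsetUr _ _).
  by rewrite addnS; apply: (Rule1 vB'); apply: IH; apply: grow.
- move=> k B v w [vB Ew] win IH B' sB.
  have [sBB' subB'] := sub' _ _ sB.
  case: (boolP (w \in B')) => wB'; first by apply: IH; apply: stay.
  have vw : adj v w.
    have : w \in [set w] by rewrite inE.
    by rewrite -Ew !inE => /andP[].
  case: (boolP (adj' v w)) => vw'; last exact: (missing _ _ _ _ _ sB vB wB' vw vw' win).
  apply: (Rule2 (v := v) (w := w)); last by apply: IH; apply: grow.
  split; first exact: subsetP vB.
  apply/setP => z; rewrite !inE andbT.
  apply/andP/eqP => [[zB' vz]|-> //].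
  apply/set1P; rewrite -Ew !inE subB' // !andbT.
  by apply: contra zB' => /(subsetP sBB').
move=> k B S reply SP cardS resp win IH B' sB.
have [sBB' subB'] := sub' _ _ sB.
(* If the reply to some answer blues nothing outside B', or forces along a
   missing edge, then B' is already won and no announcement is needed. *)
have [//|lost] := boolp.EM (blue_wins q adj' (d + k) B').
have forceS (R : {set {set T}}) : R \subset S -> R != set0 ->
     exists v w, [/\ forces adj B (B :|: cover R) v w, w \notin B',
                     adj' v w & blue_wins q adj' (d + k) (w |: B')].
  move=> sR R0; have IHR := IH R sR R0; have winR := win R sR R0.
  have [E|[v [w [[vB Ew] E]]]] := resp R sR R0; rewrite E in IHR winR.
    by case: lost; apply: IHR.
  have vw : adj v w.
    have : w \in [set w] by rewrite inE.
    by rewrite -Ew !inE => /andP[].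
  exists v, w; split; first by [].
  - by apply/negP => wB'; apply: lost; apply: IHR; apply: stay.
  - apply/negP => /negP vw'; apply: lost.
    case: (boolP (w \in B')) => wB'; first by apply: IHR; apply: stay.
    exact: (missing _ _ _ _ _ sB vB wB' vw vw' winR).
  - by apply: IHR; apply: grow.
have [S' [S'P cardS' _ forceS']] := announce_transversal
  (P := blue_wins q adj' (d + k)) adj_sym adj'_sym sBB' subB' SP forceS.
have /boolp.choice[reply' replyP] : forall R : {set {set T}}, exists C,
    R \subset S' -> R != set0 ->
    response adj' B' (B' :|: cover R) C /\ blue_wins q adj' (d + k) C.
  move=> R; case: (boolP ((R \subset S') && (R != set0))); last first.
    by move=> nR; exists B' => sR R0; rewrite sR R0 in nR.
  case/andP => sR R0; have [v [w [vw winw]]] := forceS' R sR R0.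
  by exists (w |: B') => _ _; split => //; right; exists v, w.
apply: (Rule3 (S := S') (reply := reply') S'P); first by rewrite cardS'.
  by move=> R sR R0; have [] := replyP R sR R0.
by move=> R sR R0; have [] := replyP R sR R0.
Qed.

(** * Deleting an edge *)

Lemma del_edge_sym {T : finType} {adj : rel T} (x y : T) :
  symmetric adj -> symmetric (del_edge adj x y).
Proof. by move=> adj_sym u v; rewrite /del_edge /= adj_sym setUC. Qed.

Lemma del_edge_missing {T : finType} {adj : rel T} {x y u v : T} :
  adj u v -> ~~ del_edge adj x y u v -> [set u; v] = [set x; y].
Proof. by rewrite /del_edge /= => -> /negPn/eqP. Qed.

Lemma blue_wins_add_edge {T : finType} {q : nat} {adj : rel T} {x y : T}
    {k : nat} {B B' : {set T}} :
  symmetric adj -> blue_wins q (del_edge adj x y) k B ->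
  B :|: [set x; y] \subset B' -> blue_wins q adj k B'.
Proof.
move=> adj_sym win sB; rewrite -[k]add0n.
apply: (blue_wins_transfer [set x; y] 0 (del_edge_sym x y adj_sym) adj_sym
  _ _ _ _ _ win sB) => [u v vxy uv|k' B1 B1' v w _ _ _ /andP[->] //].
rewrite /del_edge /= uv; apply: contra vxy => /eqP <-.
by rewrite !inE eqxx orbT.
Qed.

Lemma blue_wins_del_edge {T : finType} {q : nat} {adj : rel T} {x y : T}
    {k : nat} {B B' : {set T}} :
  symmetric adj -> blue_wins q adj k B ->
  B :|: [set x; y] \subset B' -> blue_wins q (del_edge adj x y) k B'.
Proof.
move=> adj_sym win sB; rewrite -[k]add0n.
apply: (blue_wins_transfer [set x; y] 0 adj_sym (del_edge_sym x y adj_sym)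
  _ _ _ _ _ win sB) => [u v _ /andP[] //|k' B1 B1' v w sB1 _ wB1' vw].
move=> /(del_edge_missing vw) Evw.
by case/negP: wB1'; apply: (subsetP sB1); rewrite -Evw !inE eqxx !orbT.
Qed.

(** The reserve token buys the vertex that would have been forced along xy;
    the forcing vertex is the other endpoint, so both become blue. *)
Lemma blue_wins_del_edge_token {T : finType} {q : nat} {adj : rel T} {x y : T}
    {k : nat} {B : {set T}} :
  symmetric adj -> blue_wins q adj k B ->
  blue_wins q (del_edge adj x y) k.+1 B.
Proof.
move=> adj_sym win.
rewrite -add1n.
apply: (blue_wins_transfer set0 1 adj_sym (del_edge_sym x y adj_sym)
  _ _ _ _ _ win); last by rewrite setU0.
  by move=> u v _ /andP[].
move=> {win}k {}B B' v w; rewrite setU0 => sBB' vB wB' vw.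
move=> /(del_edge_missing vw) Evw win.
apply: (Rule1 wB'); apply: (blue_wins_del_edge adj_sym win).
rewrite -Evw !subUset !sub1set !inE eqxx (subsetP sBB' _ vB) !orbT andbT /=.
exact: subset_trans sBB' (subsetUr _ _).
Qed.

(** * The forcing number *)

Lemma Zq_wins {T : finType} (q : nat) (adj : rel T) :
  blue_wins q adj (Zq q adj) set0.
Proof. by rewrite /Zq; case: ex_minnP => k /boolp.asboolP. Qed.

Lemma Zq_le {T : finType} {q : nat} {adj : rel T} {k : nat} :
  blue_wins q adj k set0 -> Zq q adj <= k.
Proof.
by move=> win; rewrite /Zq; case: ex_minnP => m _; apply; apply/boolp.asboolP.
Qed.

(* As naturals, m - 2 <= n with truncated subtraction is equivalent to
   m <= n + 2, so it agrees with the inequality between integers. *)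
Theorem theorem2p6 (T : finType) (adj : rel T)
    (adj_sym : symmetric adj) (adj_irr : irreflexive adj)
    (q : nat) (x y : T) (xy_edge : adj x y) :
  Zq q adj - 2 <= Zq q (del_edge adj x y) <= Zq q adj + 1.
Proof.
apply/andP; split; last first.
  by rewrite addn1; apply/Zq_le/blue_wins_del_edge_token/Zq_wins.
rewrite leq_subLR add2n; apply: Zq_le.
have xy : y != x by apply: contraTneq xy_edge => ->; rewrite adj_irr.
apply: (Rule1 (v := x)); first by rewrite inE.
apply: (Rule1 (v := y)); first by rewrite !inE orbF.
apply: (blue_wins_add_edge adj_sym (Zq_wins q (del_edge adj x y))).
by rewrite set0U setU0 setUC.
Qed.
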